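(* The function $\gamma\mapsto Q(\sqrt{\gamma})$ is log-convex on $\gamma>0$, i.e. $\log Q(\sqrt\gamma)$ is a convex function of $\gamma\in(0,\infty)$.
   Context: $Q(x)=\frac{1}{\sqrt{2\pi}}\int_x^\infty e^{-t^2/2}\,dt$. *)

(* Defs.v *)
From mathcomp Require Import all_boot all_order all_algebra.
From mathcomp Require Import all_classical all_reals all_analysis.

Set Implicit Arguments.
Unset Strict Implicit.
Unset Printing Implicit Defensive.

Import Order.TTheory GRing.Theory Num.Theory.
Import numFieldNormedType.Exports.

Local Open Scope classical_set_scope.
Local Open Scope ring_scope.

Definition gaussQ (R : realType) (x : R) : R :=
  (Num.sqrt (2 * pi))^-1 *
  \int[lebesgue_measure]_(t in `[x, +oo[) expR (- (t ^+ 2 / 2)).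

(* Positivity is part of log-convexity; it cannot be omitted because [ln] is
   total, with value 0 on nonpositive arguments. *)
Definition log_convex (R : realType) (D : set R) (f : R -> R) : Prop :=
  {in D, forall x, 0 < f x} /\ convex_function D (fun x => ln (f x)).

(* Main.v *)
Require Import Defs.
From mathcomp Require Import all_boot all_order all_algebra.
From mathcomp Require Import all_classical all_reals all_analysis.
From mathcomp Require Import ring lra.

(** Translating the variable, [sqrt (2 pi) * Q (sqrt g)] is the integral over
    [s >= 0] of [exp (- (sqrt g + s)^2 / 2)], whose exponent
    [- g / 2 - s * sqrt g - s^2 / 2] is convex in [g] because [sqrt] is concave.
    A mixture of log-convex functions is log-convex, by Hoelder's inequality;
    for two points this is the pointwise convexity inequality of [exp], applied
    to the integrands normalized to have integral 1. *)

Import Order.TTheory GRing.Theory Num.Theory.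
Import numFieldNormedType.Exports.

Local Open Scope classical_set_scope.
Local Open Scope ring_scope.

Lemma normal_fun1E (R : realType) (m t : R) :
  normal_fun m 1 t = expR (- ((t - m) ^+ 2 / 2)).
Proof. by rewrite /normal_fun expr1n mulNr. Qed.

(** Up to the factor [normal_peak 1], the integrand is the normal density of mean [- x] and standard
    deviation 1, so it inherits integrability from that density. *)
Lemma integrable_shifted_gauss (R : realType) (x : R) :
  (@lebesgue_measure R).-integrable `[0, +oo[
    (EFin \o (fun s => expR (- ((x + s) ^+ 2 / 2)))).
Proof.
have s1 : (1 : R) != 0 by exact: oner_neq0.
have h : normal_pdf (- x) 1 =
    (fun s => normal_peak 1 * expR (- ((x + s) ^+ 2 / 2))).
  by apply/funext => s; rewrite normal_pdfE//= normal_fun1E opprK (addrC s).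
apply: (@integrableS _ _ _ _ setT) => //.
have /= := @integrableZl _ _ _ lebesgue_measure _ measurableT
  (normal_peak 1)^-1 _ (integrable_normal_pdf (- x) 1).
apply: eq_integrable => // s _.
by rewrite h /= -EFinM mulKf// gt_eqF// normal_peak_gt0.
Qed.

(** The substitution [t = x + s] moves the dependence on [x] from the domain into the integrand, so
    that integrals for different [x] can be compared pointwise in [s]. *)
Lemma integral_gauss_shift (R : realType) (x : R) :
  \int[lebesgue_measure]_(t in `[x, +oo[) expR (- (t ^+ 2 / 2)) =
  \int[lebesgue_measure]_(s in `[0, +oo[) expR (- ((x + s) ^+ 2 / 2)).
Proof.
have D1 : derive1 (fun s : R => x + s) = cst 1.
  by apply/funext => s; rewrite derive1E deriveD// derive_cst derive_id add0r.
have cG : continuous (fun t : R => expR (- (t ^+ 2 / 2))).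
  move=> t; apply: continuous_comp; last exact: continuous_expR.
  apply: cvgN; apply: cvgMr_tmp; exact: exprn_continuous.
rewrite /Rintegral; congr fine.
have := @increasing_ge0_integration_by_substitutiony R (fun s => x + s)
  (fun t => expR (- (t ^+ 2 / 2))) 0.
rewrite addr0 D1 => ->.
- by apply: eq_integral => s _ /=; rewrite mulr1.
- by move=> a b _ _; rewrite ltrD2l.
- by move=> a _; exact: cst_continuous.
- exact: is_cvg_cst.
- exact: is_cvg_cst.
- split; first by move=> a _; exact: derivableD.
  by apply: cvg_at_right_filter; apply: cvgD; [exact: cvg_cst|exact: cvg_id].
- exact: cvg_addrl.
- exact: continuous_subspaceT.
- by move=> t _; exact: expR_ge0.
Qed.

(** For [0 <= x] the integrand decreases in [s >= 0], so on the unit interval it is at least its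
    value at [s = 1]; that positive constant bounds the whole integral from below. *)
Lemma integral_shifted_gauss_gt0 (R : realType) (x : R) : 0 <= x ->
  0 < \int[lebesgue_measure]_(s in `[0, +oo[) expR (- ((x + s) ^+ 2 / 2)).
Proof.
move=> x0; have ki := @integrable_shifted_gauss R x.
have ki1 : (@lebesgue_measure R).-integrable `[0, 1]
    (EFin \o (fun s => expR (- ((x + s) ^+ 2 / 2)))).
  by apply: integrableS ki => //; apply: subset_itvl; rewrite bnd_simp.
have : expR (- ((x + 1) ^+ 2 / 2)) <=
    \int[lebesgue_measure]_(s in `[0, 1]) expR (- ((x + s) ^+ 2 / 2)).
  have -> : expR (- ((x + 1) ^+ 2 / 2)) =
    \int[lebesgue_measure]_(s in `[0, 1]) (cst (expR (- ((x + 1) ^+ 2 / 2))) s).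
    rewrite Rintegral_cst//= lebesgue_measure_itv/= lte_fin ltr01.
    by rewrite oppr0 adde0 /= mulr1.
  apply: le_Rintegral => //.
    apply: continuous_compact_integrable; first exact: segment_compact.
    by apply: continuous_subspaceT; exact: cst_continuous.
  move=> s /=; rewrite in_itv/= => /andP[s0 s1].
  by rewrite ler_expR; nra.
move=> /(lt_le_trans (expR_gt0 _))/lt_le_trans; apply.
rewrite /Rintegral fine_le ?integrable_fin_num//.
apply: ge0_subset_integral => //.
- by case/integrableP : ki.
- by apply: subset_itvl; rewrite bnd_simp.
Qed.

Lemma gaussQ_gt0 (R : realType) (x : R) : 0 <= x -> 0 < gaussQ x.
Proof.
move=> x0; rewrite /gaussQ integral_gauss_shift mulr_gt0//.
  by rewrite invr_gt0 sqrtr_gt0 mulr_gt0// pi_gt0.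
exact: integral_shifted_gauss_gt0.
Qed.

Lemma sqrtr_concave (R : realType) (t a b : R) :
  0 <= t <= 1 -> 0 <= a -> 0 <= b ->
  t * Num.sqrt a + (1 - t) * Num.sqrt b <= Num.sqrt (t * a + (1 - t) * b).
Proof.
move=> /andP[t0 t1] a0 b0.
rewrite -[leLHS]ger0_norm; last by rewrite addr_ge0// mulr_ge0 ?subr_ge0.
rewrite -sqrtr_sqr ler_wsqrtr//.
have ha := sqr_sqrtr a0; have hb := sqr_sqrtr b0.
(* This is exactly the difference of the two squared sides. *)
have : 0 <= t * (1 - t) * (Num.sqrt a - Num.sqrt b) ^+ 2.
  by rewrite mulr_ge0 ?sqr_ge0// mulr_ge0// subr_ge0.
move: ha hb; move: (Num.sqrt a) (Num.sqrt b) => u v <- <-; lra.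
Qed.

Lemma expR_Jensen (R : realType) (t a b : R) : 0 <= t <= 1 ->
  expR (t * a + (1 - t) * b) <= t * expR a + (1 - t) * expR b.
Proof. by move=> /andP[t0 t1]; exact: (convex_expR (Itv01 t0 t1) a b). Qed.

(** Convexity of [expR] at [u - ln A] and [v - ln B], multiplied by [A^t B^(1-t)]. With [A] and [B]
    the integrals of [expR u] and [expR v], the right-hand side integrates to [A^t B^(1-t)], the
    bound in Hoelder's inequality. *)
Lemma expR_normalized_Jensen (R : realType) (t A B u v : R) :
  0 <= t <= 1 -> 0 < A -> 0 < B ->
  expR (t * u + (1 - t) * v) <=
  expR (t * ln A + (1 - t) * ln B) * t / A * expR u +
  expR (t * ln A + (1 - t) * ln B) * (1 - t) / B * expR v.
Proof.
move=> t01 A0 B0.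
have := expR_Jensen R t (u - ln A) (v - ln B) t01.
rewrite (expRB u) (expRB v) !lnK ?posrE// => J.
have -> : t * u + (1 - t) * v = (t * ln A + (1 - t) * ln B) +
  (t * (u - ln A) + (1 - t) * (v - ln B)) by ring.
rewrite expRD; apply: (le_trans (ler_wpM2l (expR_ge0 _) J)).
by rewrite le_eqVlt; apply/orP; left; apply/eqP; ring.
Qed.

(** Once the squares are expanded, the terms in [g] and [s^2] are affine in [g] and cancel; what
    remains is concavity of the square root multiplied by [s >= 0]. *)
Lemma shifted_gauss_exponent_convex (R : realType) (t a b s : R) :
  0 <= t <= 1 -> 0 <= a -> 0 <= b -> 0 <= s ->
  - ((Num.sqrt (t * a + (1 - t) * b) + s) ^+ 2 / 2) <=
  t * - ((Num.sqrt a + s) ^+ 2 / 2) + (1 - t) * - ((Num.sqrt b + s) ^+ 2 / 2).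
Proof.
move=> t01 a0 b0 s0; have /andP[t0 t1] := t01.
have c0 : 0 <= t * a + (1 - t) * b by rewrite addr_ge0// mulr_ge0// subr_ge0.
have := ler_wpM2l s0 (sqrtr_concave _ _ _ _ t01 a0 b0).
move: (sqr_sqrtr a0) (sqr_sqrtr b0) (sqr_sqrtr c0).
move: (Num.sqrt a) (Num.sqrt b) (Num.sqrt _) => u v w <- <- Hw Hs.
rewrite !sqrrD Hw; lra.
Qed.

Lemma ln_integral_shifted_gauss_convex (R : realType) (t a b : R) :
  let I g := \int[@lebesgue_measure R]_(s in `[0, +oo[)
               expR (- ((Num.sqrt g + s) ^+ 2 / 2)) in
  0 <= t <= 1 -> 0 <= a -> 0 <= b ->
  ln (I (t * a + (1 - t) * b)) <= t * ln (I a) + (1 - t) * ln (I b).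
Proof.
move=> I t01 a0 b0.
have I_gt0 g : 0 < I g by exact: integral_shifted_gauss_gt0.
set M := leRHS.
(* Here [expR M] is [I(a)^t I(b)^(1-t)], so the goal becomes Hoelder's bound. *)
rewrite -ler_expR lnK ?posrE//.
have ki g := @integrable_shifted_gauss R (Num.sqrt g).
have kZ r g : (@lebesgue_measure R).-integrable `[0, +oo[
    (EFin \o (fun s => r * expR (- ((Num.sqrt g + s) ^+ 2 / 2)))).
  have := @integrableZl _ _ _ lebesgue_measure _
    (measurable_itv `[0, +oo[) r _ (ki g).
  by apply: eq_integrable.
apply: (@le_trans _ _ (\int[@lebesgue_measure R]_(s in `[0, +oo[)
  (expR M * t / I a * expR (- ((Num.sqrt a + s) ^+ 2 / 2)) +
   expR M * (1 - t) / I b * expR (- ((Num.sqrt b + s) ^+ 2 / 2))))).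
  apply: le_Rintegral => //.
    have := @integrableD _ _ _ lebesgue_measure _ (measurable_itv `[0, +oo[) _ _
      (kZ (expR M * t / I a) a) (kZ (expR M * (1 - t) / I b) b).
    by apply: eq_integrable.
  move=> s /=; rewrite in_itv/= andbT => s0.
  apply: le_trans (expR_normalized_Jensen _ _ _ _ _ _ t01 (I_gt0 a) (I_gt0 b)).
  by rewrite ler_expR; exact: shifted_gauss_exponent_convex.
(* The normalized integrands contribute the weights [t] and [1 - t], which add up to 1. *)
have E : expR M * t / I a * I a + expR M * (1 - t) / I b * I b = expR M.
  move: (I a) (I b) (expR M) (I_gt0 a) (I_gt0 b) => A B m A0 B0.
  by rewrite !mulfVK ?lt0r_neq0//; ring.
rewrite RintegralD// RintegralZl// RintegralZl// -[leRHS]E.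
exact: lexx.
Qed.

Lemma ln_gaussQ_sqrt_convex (R : realType) (t a b : R) :
  0 <= t <= 1 -> 0 <= a -> 0 <= b ->
  ln (gaussQ (Num.sqrt (t * a + (1 - t) * b))) <=
  t * ln (gaussQ (Num.sqrt a)) + (1 - t) * ln (gaussQ (Num.sqrt b)).
Proof.
move=> t01 a0 b0.
pose I g := \int[@lebesgue_measure R]_(s in `[0, +oo[)
              expR (- ((Num.sqrt g + s) ^+ 2 / 2)).
have : ln (I (t * a + (1 - t) * b)) <= t * ln (I a) + (1 - t) * ln (I b).
  exact: ln_integral_shifted_gauss_convex.
(* The normalizing factor only adds a constant to the logarithm, which leaves convexity
   unchanged. *)
have lnQ g : ln (gaussQ (Num.sqrt g)) = ln (Num.sqrt (2 * pi))^-1 + ln (I g).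
  rewrite /gaussQ integral_gauss_shift lnM// posrE.
    by rewrite invr_gt0 sqrtr_gt0 mulr_gt0// pi_gt0.
  exact: integral_shifted_gauss_gt0.
rewrite !lnQ; clear lnQ; clearbody I.
move: (ln (I _)) (ln (I a)) (ln (I b)) (ln _^-1) => u v w k; lra.
Qed.

Theorem lemma3 (R : realType) :
  log_convex `]0, +oo[ (fun gamma : R => gaussQ (Num.sqrt gamma)).
Proof.
split=> [x _|t x y]; first exact/gaussQ_gt0/sqrtr_ge0.
rewrite !inE/= !in_itv/= !andbT => x0 y0.
have t01 : 0 <= t%:num <= 1 by apply/andP; split.
exact: (ln_gaussQ_sqrt_convex R t%:num x y t01 (ltW x0) (ltW y0)).
Qed.
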